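(* Suppose that problem (P) is feasible and that assumption (A) is satisfied. Let $\hat p_1$ be the optimal value (infimum) of problem (P) and let $\hat p_2$ be the optimal value (infimum) of its enhanced semidefinite relaxation (R). Then $\hat p_1=\hat p_2$. Moreover, if $(\tilde x,\tilde X)$ is an optimal solution to (R), then $\tilde x$ is an optimal solution to (P).
   Context: Let $\mathcal{S}^n$ denote the real symmetric $n\times n$ matrices and $\mathcal{H}^k$ the complex Hermitian $k\times k$ matrices; $M\succeq 0$ means that the (real symmetric or complex Hermitian) matrix $M$ is positive semidefinite, and $X\succeq Y$ means $X-Y\succeq 0$. Data: $P_0,P_1,\dots,P_d\in\mathcal{S}^n$, $q_0,q_1,\dots,q_d\in\mathbb{R}^n$, $r_0,r_1,\dots,r_d\in\mathbb{R}$, a real $m\times n$ matrix $A$, $b\in\mathbb{R}^m$, and $H_0,H_1,\dots,H_n\in\mathcal{H}^k$. Problem (P), in the variable $x\in\mathbb{R}^n$: \[ \begin{array}{rl} \min & x^TP_0x+2q_0^Tx+r_0\\ \text{s.t.} & x^TP_lx+2q_l^Tx+r_l\le 0,\quad l=1,\dots,d,\\ & Ax=b,\\ & H_0+\sum_{j=1}^n x_jH_j\succeq 0. \end{array} \] Problem (R) (the enhanced semidefinite relaxation of (P)), in the variables $x\in\mathbb{R}^n$, $X\in\mathcal{S}^n$: \[ \begin{array}{rl} \min & \operatorname{tr}(P_0X)+2q_0^Tx+r_0\\ \text{s.t.} & \operatorname{tr}(P_lX)+2q_l^Tx+r_l\le 0,\quad l=1,\dots,d,\\ & Ax=b,\quad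 AX=bx^T,\quad X\succeq xx^T,\\ & H_0+\sum_{j=1}^n x_jH_j\succeq 0. \end{array} \] Assumption (A): $P_l\succeq 0$ for $l=1,\dots,d$, and there exists a real $m\times n$ matrix $V$ such that $P_0+\frac12(V^TA+A^TV)\succeq 0$. *)

(* Defs.v *)
From HB Require Import structures.
From mathcomp Require Import all_boot all_order all_algebra.
From mathcomp Require Import all_classical all_reals ereal.
From mathcomp.real_closed Require Import complex.

Set Implicit Arguments.
Unset Strict Implicit.
Unset Printing Implicit Defensive.

Import Order.TTheory GRing.Theory Num.Theory.
Local Open Scope ring_scope.
Local Open Scope sesquilinear_scope.
Local Open Scope complex_scope.
Local Open Scope classical_set_scope.

Definition sym_psd (R : realType) (n : nat) (M : 'M[R]_n) : Prop :=
  M \is symmetricmx /\ forall v : 'cV[R]_n, 0 <= (v^T *m M *m v) 0 0.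

(* In R[i], 0 <= z means that z is real and nonnegative. *)
Definition herm_psd (R : realType) (k : nat) (M : 'M[R[i]]_k) : Prop :=
  M \is hermsymmx /\ forall v : 'cV[R[i]]_k, 0 <= (v ^t* *m M *m v) 0 0.

(* The families P_0, .., P_d and H_0, .., H_n are indexed by 'I_d.+1 and
   'I_n.+1, so that [lift ord0 i] is the index i + 1. *)
Record problem_data (R : realType) (d m n k : nat) := ProblemData {
  dP : 'I_d.+1 -> 'M[R]_n;
  dq : 'I_d.+1 -> 'cV[R]_n;
  dr : 'I_d.+1 -> R;
  dA : 'M[R]_(m, n);
  db : 'cV[R]_m;
  dH : 'I_n.+1 -> 'M[R[i]]_k;
  dP_sym : forall l, dP l \is symmetricmx;
  dH_herm : forall j, dH j \is hermsymmx }.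

Section Problems.
Context (R : realType) (d m n k : nat) (D : problem_data R d m n k).

Definition lmi (x : 'cV[R]_n) : 'M[R[i]]_k :=
  dH D ord0 + \sum_(j < n) (x j 0)%:C *: dH D (lift ord0 j).

Definition quadf (l : 'I_d.+1) (x : 'cV[R]_n) : R :=
  (x^T *m dP D l *m x) 0 0 + 2 * ((dq D l)^T *m x) 0 0 + dr D l.

Definition feasibleP : set 'cV[R]_n := [set x |
  [/\ forall l : 'I_d, quadf (lift ord0 l) x <= 0,
      dA D *m x = db D
    & herm_psd (lmi x)]].

Definition objP (x : 'cV[R]_n) : R := quadf ord0 x.

Definition liftedf (l : 'I_d.+1) (y : 'cV[R]_n * 'M[R]_n) : R :=
  \tr (dP D l *m y.2) + 2 * ((dq D l)^T *m y.1) 0 0 + dr D l.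

Definition feasibleR : set ('cV[R]_n * 'M[R]_n) := [set y |
  let: (x, X) := y in
  X \is symmetricmx /\
  [/\ forall l : 'I_d, liftedf (lift ord0 l) y <= 0,
      dA D *m x = db D,
      dA D *m X = db D *m x^T,
      sym_psd (X - x *m x^T)
    & herm_psd (lmi x)]].

Definition objR (y : 'cV[R]_n * 'M[R]_n) : R := liftedf ord0 y.

Definition assumptionA : Prop :=
  (forall l : 'I_d, sym_psd (dP D (lift ord0 l))) /\
  exists V : 'M[R]_(m, n),
    sym_psd (dP D ord0 + 2^-1 *: (V^T *m dA D + (dA D)^T *m V)).

End Problems.

Definition optimal_value (R : realType) (T : Type) (F : set T) (f : T -> R)
  : \bar R := ereal_inf [set (f x)%:E | x in F].

Definition optimal_solution (R : realType) (T : Type) (F : set T) (f : T -> R)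
    (x : T) : Prop :=
  F x /\ forall y, F y -> f x <= f y.

(* Main.v *)
Require Import Defs.
From HB Require Import structures.
From mathcomp Require Import all_boot all_order all_algebra.
From mathcomp Require Import all_classical all_reals ereal.
From mathcomp.real_closed Require Import complex.
From mathcomp Require Import ring lra.

(** Both problems have the same infimum because the second component of a
    feasible point of the relaxation can be discarded without loss.  Let
    [(x, X)] be feasible for (R) and put [Y = X - x x^T], so that [Y] is
    positive semidefinite.  Given [A x = b], the constraint [A X = b x^T]
    says exactly that [A Y = 0].  Each lifted function splits as
    [tr (P_l X) + 2 q_l^T x + r_l = (quadratic function at x) + tr (P_l Y)]
    ([liftedfE]), so everything reduces to the sign of [tr (P_l Y)].

    For a constraint, [P_l] is positive semidefinite and hence
    [tr (P_l Y) >= 0] ([mxtrace_psd_mul_ge0]): [x] is feasible for (P).  For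
    the objective, [A Y = 0] allows [P_0] to be replaced under the trace by
    the positive semidefinite matrix [P_0 + (V^T A + A^T V) / 2] of assumption
    (A), so [tr (P_0 Y) >= 0] as well ([mxtrace_psd_mod_ge0]): the objective
    of (P) at [x] is at most that of (R) at [(x, X)].

    Conversely [x |-> (x, x x^T)] embeds the feasible set of (P) into that of
    (R) with the same objective.  A map in each direction that does not
    increase the objective gives equal infima, and transports optimal
    solutions. *)

Import Order.TTheory GRing.Theory Num.Theory.
Local Open Scope ring_scope.
Local Open Scope classical_set_scope.

Lemma symmetricmxE (F : fieldType) (n : nat) (M : 'M[F]_n) :
  (M \is symmetricmx) = (M == M^T).
Proof. by rewrite is_hermitianmxE expr0 scale1r map_mx_id. Qed.

(** Polarization: the value of the form at the sum of two basis vectors is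
    [2 * P i j] once its values at each of them vanish. *)
Lemma sym_quad0_eq0 (F : realFieldType) (n : nat) (P : 'M[F]_n) :
  P^T = P -> (forall v : 'cV[F]_n, (v^T *m P *m v) 0 0 = 0) -> P = 0.
Proof.
move=> symP P0; apply/matrixP => i j; rewrite [RHS]mxE.
pose e k : 'cV[F]_n := delta_mx k 0.
have entry k l : ((e k)^T *m P *m e l) 0 0 = P k l.
  by rewrite trmx_delta -rowE -colE !mxE.
have addE (M N : 'M[F]_1) : (M + N) 0 0 = M 0 0 + N 0 0 by rewrite mxE.
have := P0 (e i + e j).
rewrite (linearD trmx) /= !mulmxDl !mulmxDr !addE !P0 !entry add0r addr0.
rewrite -[in P j i]symP mxE; lra.
Qed.

(** Induction on the rank of [P].  If [P] is nonzero, pick [v] with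
    [c = v^T P v > 0] and let [W = 1 - v v^T P / c] be the [P]-orthogonal
    projection along [v].  Then [P = P W + (P v) (P v)^T / c]: the rank-one part
    contributes [(P v)^T Q (P v) / c >= 0] to the trace, and the remainder
    [P W = W^T P W] is again positive semidefinite and of smaller rank, since
    its kernel contains that of [P] and also [v].  This is one step of
    Gaussian elimination and so takes place over any ordered field. *)
Lemma mxtrace_psd_mul_ge0 (F : realFieldType) (n : nat) (P Q : 'M[F]_n) :
  P^T = P -> (forall v : 'cV[F]_n, 0 <= (v^T *m P *m v) 0 0) ->
  (forall v : 'cV[F]_n, 0 <= (v^T *m Q *m v) 0 0) -> 0 <= \tr (P *m Q).
Proof.
move=> symP psdP psdQ.
have [r] := ubnP (\rank P); elim: r => // r IH in P symP psdP *.
rewrite ltnS => rkP.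
have [[v Pv]|noV] := pselect (exists v : 'cV[F]_n, (v^T *m P *m v) 0 0 != 0);
  last first.
  rewrite (_ : P = 0) ?mul0mx ?mxtrace0//.
  apply: sym_quad0_eq0 => // v; apply: contrapT => /eqP Pv.
  by apply: noV; exists v.
set c := (v^T *m P *m v) 0 0 in Pv.
have c_gt0 : 0 < c by rewrite lt_neqAle eq_sym Pv psdP.
have Ec : v^T *m P *m v = c%:M by rewrite [LHS]mx11_scalar.
pose W := 1%:M - c^-1 *: (v *m (v^T *m P)).
have Wv : W *m v = 0.
  rewrite mulmxBl mul1mx -scalemxAl -mulmxA Ec mul_mx_scalar scalerA.
  by rewrite mulVf // scale1r subrr.
have WW : W *m W = W.
  by rewrite {2}/W mulmxBr mulmx1 -scalemxAr !mulmxA Wv !mul0mx scaler0 subr0.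
have EPW : P *m W = P - c^-1 *: (P *m v *m (P *m v)^T).
  by rewrite mulmxBr mulmx1 -scalemxAr trmx_mul symP !mulmxA.
have symPW : (P *m W)^T = P *m W.
  by rewrite EPW linearB linearZ /= trmx_mul trmxK symP.
have EWP : W^T *m P = P *m W by rewrite -[RHS]symPW trmx_mul symP.
have -> : P *m Q = P *m W *m Q + c^-1 *: (P *m v *m ((P *m v)^T *m Q)).
  by rewrite EPW mulmxBl -scalemxAl -!mulmxA subrK.
rewrite mxtraceD mxtraceZ addr_ge0 //; last first.
  by rewrite mulr_ge0 ?invr_ge0 ?(ltW c_gt0) // mxtrace_mulC trace_mx11 psdQ.
apply: IH => // [u|].
  have -> : u^T *m (P *m W) *m u = (W *m u)^T *m P *m (W *m u).
    by rewrite trmx_mul -(mulmxA u^T W^T) EWP -!mulmxA (mulmxA W) WW.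
  exact: psdP.
apply: leq_trans rkP; apply: rank_ltmx; rewrite /ltmx -{1}EWP submxMl /=.
(* If [P = D (P W)] held, then [P v] would vanish because [W v = 0]. *)
apply/negP => /submxP [D EP]; move/eqP: Pv; apply.
by rewrite /c EP -!mulmxA Wv !mulmx0 mxE.
Qed.

(** Positive semidefiniteness of [P] modulo the rows of [A] suffices when
    [A Y = 0], because the correction [V^T A + A^T V] is then invisible to the
    trace: [tr (V^T A Y) = 0], and [tr (A^T V Y) = tr (V (A Y)^T) = 0] as [Y] is
    symmetric. *)
Lemma mxtrace_psd_mod_ge0 (R : realType) (m n : nat) (A V : 'M[R]_(m, n))
    (P Y : 'M[R]_n) :
  sym_psd (P + 2^-1 *: (V^T *m A + A^T *m V)) -> sym_psd Y -> A *m Y = 0 ->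
  0 <= \tr (P *m Y).
Proof.
move=> [symP psdP] [symY psdY] AY0.
rewrite symmetricmxE in symP; rewrite symmetricmxE in symY.
have := mxtrace_psd_mul_ge0 _ _ _ Y (esym (eqP symP)) psdP psdY.
have trAVY : \tr (A^T *m V *m Y) = 0.
  rewrite -mulmxA mxtrace_mulC -mulmxA [in Y *m _](eqP symY) -trmx_mul AY0.
  by rewrite trmx0 mulmx0 mxtrace0.
rewrite mulmxDl -scalemxAl mulmxDl -mulmxA AY0 mulmx0 add0r mxtraceD mxtraceZ.
by rewrite trAVY mulr0 addr0.
Qed.

Section Relaxation.
Context (R : realType) (d m n k : nat) (D : problem_data R d m n k).

Lemma liftedfE (l : 'I_d.+1) (x : 'cV[R]_n) (X : 'M[R]_n) :
  liftedf D l (x, X) = quadf D l x + \tr (dP D l *m (X - x *m x^T)).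
Proof.
rewrite /liftedf /quadf /= mulmxBr linearB /= [in RHS]mulmxA.
rewrite [\tr (_ *m x *m _)]mxtrace_mulC mulmxA trace_mx11; ring.
Qed.

Lemma feasibleR_gap (x : 'cV[R]_n) (X : 'M[R]_n) :
  feasibleR D (x, X) -> dA D *m (X - x *m x^T) = 0.
Proof. by case=> _ [_ Ax AX _ _]; rewrite mulmxBr AX mulmxA Ax subrr. Qed.

Lemma feasibleR_fst (x : 'cV[R]_n) (X : 'M[R]_n) :
  assumptionA D -> feasibleR D (x, X) -> feasibleP D x.
Proof.
move=> [psdP _] [_ [cons Ax _ [_ psdY] H]]; split => // l.
have [] := psdP l; rewrite symmetricmxE => /eqP /esym symPl psdPl.
apply: le_trans (cons l); rewrite liftedfE lerDl.
exact: mxtrace_psd_mul_ge0.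
Qed.

Lemma objP_le_objR (x : 'cV[R]_n) (X : 'M[R]_n) :
  assumptionA D -> feasibleR D (x, X) -> objP D x <= objR D (x, X).
Proof.
move=> [_ [V psdV]] fX; rewrite /objR liftedfE lerDl.
apply: mxtrace_psd_mod_ge0 psdV _ (feasibleR_gap _ _ fX).
by case: fX => _ [].
Qed.

Lemma objR_rank1 (x : 'cV[R]_n) : objR D (x, x *m x^T) = objP D x.
Proof. by rewrite /objR liftedfE subrr mulmx0 mxtrace0 addr0. Qed.

Lemma feasibleR_rank1 (x : 'cV[R]_n) :
  feasibleP D x -> feasibleR D (x, x *m x^T).
Proof.
move=> [cons Ax H]; split; first by rewrite symmetricmxE trmx_mul trmxK.
split => // [l||].
- by rewrite liftedfE subrr mulmx0 mxtrace0 addr0.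
- by rewrite mulmxA Ax.
- rewrite subrr; split; first by rewrite symmetricmxE trmx0.
  by move=> v; rewrite mulmx0 mul0mx mxE.
Qed.

End Relaxation.

Lemma optimal_value_le (R : realType) (S T : Type) (F : set S) (G : set T)
    (f : S -> R) (g : T -> R) :
  (forall y, G y -> exists2 x, F x & f x <= g y) ->
  (optimal_value F f <= optimal_value G g)%E.
Proof.
move=> FG; apply: le_ereal_inf_tmp => _ [y Gy <-].
have [x Fx fx] := FG y Gy.
by apply: ge_ereal_inf; exists (f x)%:E; [exists x | rewrite lee_fin].
Qed.

Theorem theorem5p1 (R : realType) (d m n k : nat) (D : problem_data R d m n k)
    (hfeas : feasibleP D !=set0) (hA : assumptionA D) :
  optimal_value (feasibleP D) (objP D) = optimal_value (feasibleR D) (objR D) /\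
  forall (x : 'cV[R]_n) (X : 'M[R]_n),
    optimal_solution (feasibleR D) (objR D) (x, X) ->
    optimal_solution (feasibleP D) (objP D) x.
Proof.
split.
  apply/eqP; rewrite eq_le; apply/andP; split; apply: optimal_value_le.
    move=> [x X] fX; exists x; first exact: feasibleR_fst fX.
    exact: objP_le_objR.
  move=> x fx; exists (x, x *m x^T); first exact: feasibleR_rank1.
  by rewrite objR_rank1.
move=> x X [fX optX]; split; first exact: feasibleR_fst fX.
move=> y fy; apply: le_trans (objP_le_objR _ _ _ _ _ _ _ _ hA fX) _.
by rewrite -(objR_rank1 _ _ _ _ _ D y); apply/optX/feasibleR_rank1.
Qed.
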